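(* (1) In each of the following groups of consecutive patterns of length $4$, any two patterns in the same group are super-strongly Wilf equivalent: (i) $0102, 0112$; (ii) $0021, 0121$; (iii) $1002, 1012, 1102$; (iv) $0100, 0110$; (v) $2013, 2103$; (vi) $1200, 1210, 1220$; (vii) $0211, 0221$; (viii) $1000, 1110$; (ix) $1001, 1011, 1101$; (x) $2100, 2210$; (xi) $2001, 2011, 2101, 2201$; (xii) $2012, 2102$; (xiii) $2010, 2110, 2120$; (xiv) $3012, 3102$. (2) Conversely, if $p\neq p'$ are consecutive patterns of length $4$ that are Wilf equivalent, then $p$ and $p'$ belong to the same group among (i)--(xiv). In particular, the only generalized Wilf equivalences (of any of the three types) between distinct consecutive patterns of length 4 are those listed in (1).
   Context: An inversion sequence of length $n$ is an integer sequence $e=e_1e_2\dots e_n$ with $0\le e_i<i$ for all $i$; $\mathbf{I}_n$ denotes the set of these. A pattern of length $r$ is a sequence $p=p_1\dots p_r$ with $p_i\in\{0,\dots,r-1\}$ such that whenever a value $j>0$ appears in $p$, the value $j-1$ also appears. The reduction of an integer word $w$ is obtained by replacing every occurrence of the $i$-th smallest distinct value of $w$ by $i-1$, for all $i$. An inversion sequence $e$ has an occurrence of the consecutive pattern $p$ (of length $r$) in position $i$ if the reduction of $e_ie_{i+1}\dots e_{i+r-1}$ equals $p$; $\mathrm{Em}(p,e)$ is the set of such positions $i$; $e$ avoids $p$ if $\mathrm{Em}(p,e)=\emptyset$, and $\mathbf{I}_n(p)$ is the set of $e\in\mathbf{I}_n$ avoiding $p$. Two consecutive patterns $p,p'$ are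 Wilf equivalent if $|\mathbf{I}_n(p)|=|\mathbf{I}_n(p')|$ for all $n$; strongly Wilf equivalent if for all $n,m$ the number of $e\in\mathbf{I}_n$ with exactly $m$ occurrences of $p$ equals that for $p'$; super-strongly Wilf equivalent if $|\{e\in\mathbf{I}_n:\mathrm{Em}(p,e)=T\}|=|\{e\in\mathbf{I}_n:\mathrm{Em}(p',e)=T\}|$ for all $n$ and all $T\subseteq[n]$. Super-strong implies strong implies Wilf equivalence. *)

(* Defs.v *)
From mathcomp Require Import all_boot.
Set Implicit Arguments. Unset Strict Implicit. Unset Printing Implicit Defensive.

(* Inversion sequences of length n, as n-tuples of values in 'I_n
   (every e_i < i <= n, so values are < n).  Index i : 'I_n is 0-based,
   so the paper's condition 0 <= e_{i+1} < i+1 reads  val (tnth e i) <= i. *)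
Definition invseqs (n : nat) : {set n.-tuple 'I_n} :=
  [set e : n.-tuple 'I_n | [forall i : 'I_n, val (tnth e i) <= i]].

Definition is_pattern (p : seq nat) : bool :=
  all (fun x => x < size p) p && all (fun j => (0 < j) ==> (j.-1 \in p)) p.

Definition red (w : seq nat) : seq nat :=
  map (fun x => index x (sort leq (undup w))) w.

Definition occ (p e : seq nat) (i : nat) : bool :=
  (i + size p <= size e) && (red (take (size p) (drop i e)) == p).

(* Em(p,e), with positions 0-based (paper's position i is our i-1). *)
Definition Em (p : seq nat) (n : nat) (e : n.-tuple 'I_n) : {set 'I_n} :=
  [set i : 'I_n | occ p (map val e) i].

Definition wilf_equiv (p p' : seq nat) : Prop :=
  forall n : nat,
    #|[set e in invseqs n | Em p e == set0]| =
    #|[set e in invseqs n | Em p' e == set0]|.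

Definition strong_wilf_equiv (p p' : seq nat) : Prop :=
  forall n m : nat,
    #|[set e in invseqs n | #|Em p e| == m]| =
    #|[set e in invseqs n | #|Em p' e| == m]|.

Definition super_strong_wilf_equiv (p p' : seq nat) : Prop :=
  forall (n : nat) (T : {set 'I_n}),
    #|[set e in invseqs n | Em p e == T]| =
    #|[set e in invseqs n | Em p' e == T]|.

Definition groups : seq (seq (seq nat)) :=
  [:: [:: [:: 0;1;0;2]; [:: 0;1;1;2]];
      [:: [:: 0;0;2;1]; [:: 0;1;2;1]];
      [:: [:: 1;0;0;2]; [:: 1;0;1;2]; [:: 1;1;0;2]];
      [:: [:: 0;1;0;0]; [:: 0;1;1;0]];
      [:: [:: 2;0;1;3]; [:: 2;1;0;3]];
      [:: [:: 1;2;0;0]; [:: 1;2;1;0]; [:: 1;2;2;0]];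
      [:: [:: 0;2;1;1]; [:: 0;2;2;1]];
      [:: [:: 1;0;0;0]; [:: 1;1;1;0]];
      [:: [:: 1;0;0;1]; [:: 1;0;1;1]; [:: 1;1;0;1]];
      [:: [:: 2;1;0;0]; [:: 2;2;1;0]];
      [:: [:: 2;0;0;1]; [:: 2;0;1;1]; [:: 2;1;0;1]; [:: 2;2;0;1]];
      [:: [:: 2;0;1;2]; [:: 2;1;0;2]];
      [:: [:: 2;0;1;0]; [:: 2;1;1;0]; [:: 2;1;2;0]];
      [:: [:: 3;0;1;2]; [:: 3;1;0;2]] ].

Definition same_group (p p' : seq nat) : bool :=
  has (fun g => (p \in g) && (p' \in g)) groups.

(* Main.v *)
Require Import Defs.
From mathcomp Require Import all_boot.
From mathcomp Require Import zify.
From Stdlib Require Import NArith.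
Set Implicit Arguments. Unset Strict Implicit. Unset Printing Implicit Defensive.

(* Super-strong equivalence.  By inclusion-exclusion over sets of positions it
   suffices to compare, for a fixed set S of marked positions, the inversion
   sequences in which every marked position carries an occurrence of p with
   those in which it carries an occurrence of q.  Interpolate by a threshold t:
   marked positions below t carry p, the others carry q.  Lowering the threshold
   past a marked position replaces one occurrence of p by one of q on the same
   values.  The patterns of a group agree in their first and last letters, so
   this does not disturb occurrences sharing one entry; occurrences of one
   pattern sharing two or more entries exist only in groups (i) and (xiii), where
   the order of p and q is chosen so that the neighbouring occurrences survive.

   Converse.  The numbers of avoiders of length 11 already separate the groups;
   they are computed by recursion on the last three entries. *)

(** * Occurrences as order isomorphisms *)

Definition follows (p : seq nat) (w : nat -> nat) : Prop :=
  forall i j, i < size p -> j < size p ->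
    (w i <= w j) = (nth 0 p i <= nth 0 p j).

Definition order_iso (p w : seq nat) : bool :=
  all (fun i => all (fun j =>
    (nth 0 w i <= nth 0 w j) == (nth 0 p i <= nth 0 p j)) (iota 0 (size p)))
    (iota 0 (size p)).

Lemma all_iotaP n (P : pred nat) :
  reflect (forall i, i < n -> P i) (all P (iota 0 n)).
Proof.
apply: (iffP allP) => H i; first by move=> ltin; apply: H; rewrite mem_iota.
by rewrite mem_iota => /H.
Qed.

Lemma order_isoP p w : reflect (follows p (nth 0 w)) (order_iso p w).
Proof.
apply: (iffP (all_iotaP _ _)) => [H i j ltip ltjp | H i ltip].
  by have /all_iotaP/(_ j ltjp)/eqP := H i ltip.
by apply/all_iotaP => j ltjp; apply/eqP/H.
Qed.

Lemma follows_lt p w i j : follows p w -> i < size p -> j < size p ->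
  (w i < w j) = (nth 0 p i < nth 0 p j).
Proof. by move=> H ltip ltjp; rewrite !ltnNge H. Qed.

Lemma follows_eq p w i j : follows p w -> i < size p -> j < size p ->
  (w i == w j) = (nth 0 p i == nth 0 p j).
Proof. by move=> H ltip ltjp; rewrite !eqn_leq !H. Qed.

Lemma follows_ext p w w' : (forall i, i < size p -> w i = w' i) ->
  follows p w -> follows p w'.
Proof. by move=> E H i j ltip ltjp; rewrite -!E // H. Qed.

Definition gapless (p : seq nat) := forall v, v.+1 \in p -> v \in p.

Lemma is_pattern_gapless p : is_pattern p -> gapless p.
Proof. by case/andP=> _ /allP H v /H. Qed.

(** Induction on the letter [nth 0 p i]: the letter just below it occurs at some [k], where the
    bound is known, and [q] increases strictly from [k] to [i]. *)
Lemma gapless_le p q : gapless p -> size p = size q -> follows p (nth 0 q) ->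
  forall i, i < size p -> nth 0 p i <= nth 0 q i.
Proof.
move=> gp eqs H i; move E: (nth 0 p i) => v.
elim: v i E => [//|v IH] i E ltip.
have /gp/(nthP 0)[k ltkp Ek] : v.+1 \in p by rewrite -E mem_nth.
by apply: leq_ltn_trans (IH k Ek ltkp) _; rewrite (follows_lt H) // Ek E.
Qed.

(** Gapless words are pointwise minimal in their order type, hence unique in it. *)
Lemma gapless_inj p q : gapless p -> gapless q -> size p = size q ->
  follows p (nth 0 q) -> p = q.
Proof.
move=> gp gq eqs H; apply: (@eq_from_nth _ 0) => // i ltip.
apply/eqP; rewrite eqn_leq (gapless_le gp) //=.
apply: (gapless_le gq); rewrite -?eqs // => k l; rewrite -eqs => ltkp ltlp.
by rewrite H.
Qed.

Lemma size_red w : size (red w) = size w.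
Proof. exact: size_map. Qed.

Lemma follows_red w : follows (red w) (nth 0 w).
Proof.
rewrite /follows size_red => i j ltiw ltjw; rewrite !(nth_map 0) //.
set s := sort leq _.
have mems k : k < size w -> nth 0 w k \in s.
  by move=> ?; rewrite mem_sort mem_undup mem_nth.
have leq_s : sorted leq s by apply: sort_sorted; exact: leq_total.
(* Strictness makes [index] monotone: an earlier place in [s] means a strictly smaller value. *)
have ltn_s : sorted ltn s.
  by rewrite ltn_sorted_uniq_leq sort_uniq undup_uniq.
apply/idP/idP => [le_w|]; last first.
  by apply: (sorted_leq_index leq_trans leqnn) => //; apply: mems.
rewrite leqNgt; apply: contraL le_w; rewrite -ltnNge.
by apply: (sorted_ltn_index ltn_trans ltn_s) => //; apply: mems.
Qed.

Lemma gapless_red w : gapless (red w).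
Proof.
move=> v /mapP[x]; set s := sort leq _ => xw Ev.
have us : uniq s by rewrite sort_uniq undup_uniq.
have memsE y : (y \in s) = (y \in w) by rewrite mem_sort mem_undup.
have ltv : v < size s by apply: ltnW; rewrite Ev index_mem memsE.
apply/mapP; exists (nth 0 s v); first by rewrite -memsE mem_nth.
by rewrite index_uniq.
Qed.

(** Both [red w] and [p] are gapless, and [red w] has the order type of [w], so [gapless_inj]
    applies. *)
Lemma red_eq p w : is_pattern p -> size w = size p ->
  (red w == p) = order_iso p w.
Proof.
move=> /is_pattern_gapless gp eqs; apply/eqP/order_isoP => [<-|H].
  exact: follows_red.
apply: gapless_inj => //; [exact: gapless_red | by rewrite size_red |].
move=> i j; rewrite size_red eqs => ltip ltjp.
by rewrite -H // follows_red // size_red eqs.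
Qed.

Lemma occP p e i : is_pattern p ->
  reflect (i + size p <= size e /\ follows p (fun k => nth 0 e (i + k)))
          (occ p e i).
Proof.
move=> pp; rewrite /occ; case: leqP => [le_e|gt_e] /=; last by right; case.
have sz : size (take (size p) (drop i e)) = size p.
  by rewrite size_take size_drop; case: ltnP => //; lia.
rewrite red_eq //.
have E k : k < size p -> nth 0 (take (size p) (drop i e)) k = nth 0 e (i + k).
  by move=> ltkp; rewrite nth_take // nth_drop.
apply: (iffP (order_isoP _ _)) => [H|[_ H]]; first split => //;
  by apply: follows_ext H => k /E.
Qed.

(** * Inversion sequences as lists *)

Fixpoint invs (n : nat) : seq (seq nat) :=
  if n is m.+1 then [seq rcons e x | e <- invs m, x <- iota 0 m.+1]
  else [:: [::]].

Lemma invsS n : invs n.+1 = [seq rcons e x | e <- invs n, x <- iota 0 n.+1].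
Proof. by []. Qed.

Lemma mem_invs n e : (e \in invs n) =
  (size e == n) && all (fun i => nth 0 e i <= i) (iota 0 n).
Proof.
elim: n e => [|n IH] e; first by rewrite inE; case: e.
rewrite invsS; apply/allpairsP/andP => [[[e' x]] []|].
  rewrite IH mem_iota => /andP[/eqP sz /all_iotaP H] ltx ->.
  rewrite [(e', x).1]/= [(e', x).2]/= size_rcons sz; split=> //.
  apply/all_iotaP => i; rewrite nth_rcons sz ltnS => lti.
  case: ltnP => [/H //|_]; case: eqP => // ->; exact: ltx.
elim/last_ind: e => [|e x _] [/eqP]; rewrite ?size_rcons // => -[sz].
move/all_iotaP => H; exists (e, x); split=> //.
  rewrite IH sz eqxx; apply/all_iotaP => i ltin.
  by have := H i (ltnW ltin); rewrite nth_rcons sz ltin.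
by have := H n (ltnSn n); rewrite mem_iota nth_rcons sz ltnn eqxx.
Qed.

Lemma invs_uniq n : uniq (invs n).
Proof.
elim: n => [//|n IH]; apply: allpairs_uniq => //; first exact: iota_uniq.
by move=> [e x] [e' x'] _ _ /= /rcons_inj[-> ->].
Qed.

Lemma card_setI_count (T : finType) (A : {set T}) (P : pred T) :
  #|[set x in A | P x]| = count P (enum A).
Proof.
rewrite cardE -size_filter; apply/perm_size/uniq_perm.
- exact: enum_uniq.
- exact/filter_uniq/enum_uniq.
- by move=> x; rewrite [RHS]mem_filter !mem_enum !inE andbC.
Qed.

Lemma perm_invseqs n :
  perm_eq [seq map val (val e) | e <- enum (invseqs n)] (invs n).
Proof.
apply: uniq_perm; [|exact: invs_uniq|].
  rewrite map_inj_uniq ?enum_uniq // => e e' /(inj_map val_inj).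
  exact: val_inj.
move=> s; rewrite mem_invs; apply/mapP/andP => [[e]|[/eqP sz /all_iotaP H]].
  rewrite mem_enum inE => /forallP H ->; rewrite size_map size_tuple.
  split=> //; apply/all_iotaP => i ltin.
  have := H (Ordinal ltin); rewrite (tnth_nth (Ordinal ltin)) /=.
  by rewrite (nth_map (Ordinal ltin)) // size_tuple.
have le_s (i : 'I_n) : nth 0 s i <= i := H i (ltn_ord i).
have lt_s (i : 'I_n) : nth 0 s i < n := leq_ltn_trans (le_s i) (ltn_ord i).
exists [tuple Ordinal (lt_s i) | i < n].
  by rewrite mem_enum inE; apply/forallP => i; rewrite tnth_mktuple; apply: le_s.
apply: (@eq_from_nth _ 0); first by rewrite size_map size_tuple.
rewrite sz => i ltin; rewrite (nth_map (Ordinal ltin)) ?size_tuple //.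
by rewrite -[i]/(val (Ordinal ltin)) -tnth_nth tnth_mktuple.
Qed.

Lemma card_invseqs n (P : pred (seq nat)) :
  #|[set e in invseqs n | P (map val (val e))]| = count P (invs n).
Proof. by rewrite card_setI_count -(permP (perm_invseqs n)) count_map. Qed.

(** * Switching an occurrence of one pattern to another *)

(* Entry [j] of the switched sequence is entry [switch_pos t p q j] of the
   original: letter [k] of [q] receives the value of the same letter in the
   occurrence of [p] at position [t]. *)
Definition switch_pos (t : nat) (p q : seq nat) (j : nat) : nat :=
  if t <= j < t + size q then t + index (nth 0 q (j - t)) p else j.

Definition switch (t : nat) (p q e : seq nat) : seq nat :=
  mkseq (fun j => nth 0 e (switch_pos t p q j)) (size e).

Definition occurs (p e : seq nat) (t : nat) : Prop :=
  t + size p <= size e /\ follows p (fun k => nth 0 e (t + k)).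

Lemma switch_pos_in t p q k : k < size q ->
  switch_pos t p q (t + k) = t + index (nth 0 q k) p.
Proof. by move=> ltkq; rewrite /switch_pos leq_addr ltn_add2l ltkq addKn. Qed.

Lemma switch_pos_out t p q j : ~~ (t <= j < t + size q) ->
  switch_pos t p q j = j.
Proof. by rewrite /switch_pos => /negbTE ->. Qed.

Lemma size_switch t p q e : size (switch t p q e) = size e.
Proof. exact: size_mkseq. Qed.

Lemma nth_switch t p q e j : t + size p <= size e -> size p = size q ->
  nth 0 (switch t p q e) j = nth 0 e (switch_pos t p q j).
Proof.
move=> le_e eqs; case: (ltnP j (size e)) => [ltj|gej]; first exact: nth_mkseq.
rewrite [LHS]nth_default ?size_switch // switch_pos_out; last first.
  by apply/negP => /andP[_]; rewrite -eqs; lia.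
by rewrite nth_default.
Qed.

Section Switch.

Variables p q : seq nat.
Hypotheses (eq_size : size p = size q) (eq_mem : p =i q).

Lemma index_letter k : k < size q -> index (nth 0 q k) p < size p.
Proof. by move=> ltkq; rewrite index_mem eq_mem mem_nth. Qed.

Lemma nth_index_letter k : k < size q ->
  nth 0 p (index (nth 0 q k) p) = nth 0 q k.
Proof. by move=> ltkq; rewrite nth_index // eq_mem mem_nth. Qed.

Lemma occurs_switch e t : occurs p e t -> occurs q (switch t p q e) t.
Proof.
move=> [le_e H]; split; first by rewrite size_switch -eq_size.
move=> i j ltiq ltjq; rewrite !nth_switch // !switch_pos_in //.
by rewrite H ?index_letter // !nth_index_letter.
Qed.

(** Switching there and back may lead to another position of the window, since [index] picks the
    first copy of a letter. The entry found there is the same, because equal letters of [p] carry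
    equal values. *)
Lemma switchK e t : occurs p e t -> switch t q p (switch t p q e) = e.
Proof.
move=> [le_e H].
apply: (@eq_from_nth _ 0) => [|j]; rewrite !size_switch // => ltj.
rewrite nth_switch ?size_switch -?eq_size // nth_switch //.
have [/andP[letj ltjt]|out_j] := boolP (t <= j < t + size p); last first.
  by rewrite !switch_pos_out // -eq_size.
have [k ltkp ->] : exists2 k, k < size p & j = t + k by exists (j - t); lia.
have ltq : index (nth 0 p k) q < size q by rewrite index_mem -eq_mem mem_nth.
rewrite switch_pos_in // switch_pos_in //.
apply/eqP; rewrite (follows_eq H) ?index_letter // nth_index_letter //.
by rewrite nth_index // -eq_mem mem_nth.
Qed.

(* A letter moving leftwards must be dominated by an earlier entry; one step
   to the left is harmless below a strictly larger entry. *)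
Definition leftward_ok : bool :=
  all (fun k => has (fun i =>
    (i <= k) && (nth 0 q k <= nth 0 p i) ||
    (i <= k.+1) && (nth 0 q k < nth 0 p i)) (iota 0 (size p)))
    (iota 0 (size q)).

Lemma switch_invs n e t : leftward_ok -> occurs p e t -> e \in invs n ->
  switch t p q e \in invs n.
Proof.
move=> /all_iotaP ok_pq [le_e H]; rewrite !mem_invs size_switch.
move=> /andP[/eqP sz /all_iotaP le_i]; rewrite sz eqxx.
apply/all_iotaP => j ltjn; rewrite nth_switch //.
have [/andP[letj ltjt]|/switch_pos_out -> //] := boolP (t <= j < t + size q);
  last exact: le_i.
have [k ltkq ->] : exists2 k, k < size q & j = t + k by exists (j - t); lia.
rewrite switch_pos_in //.
have /hasP[i] := ok_pq k ltkq; rewrite mem_iota add0n => /= ltip.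
have le_ti : nth 0 e (t + i) <= t + i.
  by apply: le_i; rewrite -sz; apply: leq_trans le_e; rewrite ltn_add2l.
have ltp := index_letter ltkq.
have := H _ _ ltp ltip; have := follows_lt H ltp ltip.
by rewrite /= nth_index_letter //; lia.
Qed.

End Switch.

(* Necessary for occurrences of [p] at [s] and of [q] at [s + d] to coexist. *)
Definition overlap (d : nat) (p q : seq nat) : bool :=
  all (fun i => all (fun j =>
    (nth 0 p (d + i) <= nth 0 p (d + j)) == (nth 0 q i <= nth 0 q j))
    (iota 0 (size p - d))) (iota 0 (size p - d)).

Lemma occurs_overlap p e s d : occurs p e s -> occurs p e (s + d) ->
  overlap d p p.
Proof.
move=> [_ H] [_ H']; apply/all_iotaP => i lti; apply/all_iotaP => j ltj.
by rewrite -(H (d + i) (d + j)) ?addnA ?H' ?eqxx //; lia.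
Qed.

(** The side named is that of the neighbour [z], which has to survive the switch of the other
    occurrence. *)
Definition stable_left (d : nat) (z p q : seq nat) : Prop :=
  forall e s, occurs z e s -> occurs p e (s + d) ->
    occurs z (switch (s + d) p q e) s.

Definition stable_right (d : nat) (z p q : seq nat) : Prop :=
  forall e t, occurs z e (t + d) -> occurs p e t ->
    occurs z (switch t p q e) (t + d).

(** A position of the window where [p] and [q] have the same letter keeps its value. *)
Lemma occurs_untouched (z p q e : seq nat) (s t : nat) :
  size p = size q -> p =i q ->
  (forall k, k < size z -> t <= s + k < t + size q ->
     nth 0 p (s + k - t) = nth 0 q (s + k - t)) ->
  occurs z e s -> occurs p e t -> occurs z (switch t p q e) s.
Proof.
move=> eq_size eq_mem eq_pq [le_z Hz] [le_p Hp].
split; first by rewrite size_switch.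
apply: follows_ext Hz => k ltkz; rewrite nth_switch //.
have [in_k|/switch_pos_out -> //] := boolP (t <= s + k < t + size q).
have [j ltjq Ej] : exists2 j, j < size q & s + k = t + j.
  by exists (s + k - t); lia.
have := eq_pq k ltkz in_k; rewrite Ej addKn switch_pos_in // => eq_j.
apply/eqP; rewrite (follows_eq Hp) ?eq_size // -?eq_size ?index_letter //.
by rewrite nth_index_letter // eq_j.
Qed.

(** Neighbours left of the threshold carry [p] and those right of it carry [q], so four of the eight
    conceivable stabilities suffice. This makes the notion asymmetric in [p] and [q]. *)
Record switchable (p q : seq nat) : Prop := Switchable {
  sw_size : size p = size q;
  sw_mem : p =i q;
  sw_leftward : leftward_ok p q && leftward_ok q p;
  sw_overlap : forall d, 0 < d < size p -> overlap d p p = overlap d q q;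
  sw_stable : forall d, 0 < d < size p -> overlap d p p ->
    [/\ stable_left d p p q, stable_left d p q p,
        stable_right d q p q & stable_right d q q p] }.

Lemma count_bij (T : eqType) (s : seq T) (P Q : pred T) (f g : T -> T) :
  uniq s ->
  (forall x, x \in s -> P x -> [/\ f x \in s, Q (f x) & g (f x) = x]) ->
  (forall x, x \in s -> Q x -> [/\ g x \in s, P (g x) & f (g x) = x]) ->
  count P s = count Q s.
Proof.
have le_count (P' Q' : pred T) (h k : T -> T) : uniq s ->
    (forall x, x \in s -> P' x -> [/\ h x \in s, Q' (h x) & k (h x) = x]) ->
    count P' s <= count Q' s.
  move=> us H; rewrite -!size_filter -(size_map h); apply: uniq_leq_size.
    rewrite map_inj_in_uniq ?filter_uniq // => x y.
    rewrite !mem_filter => /andP[Px xs] /andP[Py ys] eq_h.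
    by have [_ _ <-] := H x xs Px; have [_ _ <-] := H y ys Py; rewrite eq_h.
  move=> y /mapP[x]; rewrite !mem_filter => /andP[Px xs] ->.
  by have [-> ->] := H x xs Px.
move=> us Hf Hg; apply/eqP.
by rewrite eqn_leq (le_count _ _ f g) // (le_count _ _ g f).
Qed.

(** * Counting with prescribed marked positions *)

Section MarkedOccurrences.

Variables p q : seq nat.
Hypotheses (pat_p : is_pattern p) (pat_q : is_pattern q) (sw : switchable p q).
Variables (n : nat) (S : seq nat).

Let pat t s := if s < t then p else q.

Definition mixed (t : nat) (e : seq nat) : bool :=
  all (fun s => occ (pat t s) e s) S.

Let mixedP t e : reflect (forall s, s \in S -> occurs (pat t s) e s) (mixed t e).
Proof.
have pat_t s : is_pattern (pat t s) by rewrite /pat; case: ifP.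
by apply: (iffP allP) => H s /H /occP; apply.
Qed.

Definition spaced : Prop := forall s d, s \in S -> s + d \in S ->
  0 < d < size p -> overlap d p p.

(** Serves the switch in both directions: thresholds [t] and [t.+1] prescribe the same patterns
    except at [t]. Disjoint windows are untouched, and overlapping ones are covered by
    [sw_stable]. *)
Lemma mixed_switch t t' x y e :
  spaced -> t \in S ->
  (x = p /\ y = q /\ t' = t) \/ (x = q /\ y = p /\ t' = t.+1) ->
  (forall s, s \in S -> s != t -> occurs (pat t s) e s) ->
  occurs x e t -> mixed t' (switch t x y e).
Proof.
move=> spS tS Hxy He Hx; case: sw => eq_size eq_mem _ _ st.
have eq_size_xy : size x = size y by case: Hxy => -[-> [-> _]].
have eq_mem_xy : x =i y by case: Hxy => -[-> [-> _]].
have size_x : size x = size p by case: Hxy => -[-> _].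
have size_pat s : size (pat t s) = size p by rewrite /pat; case: ifP.
apply/mixedP => s sS.
have [->|ne_st] := eqVneq s t.
  have -> : pat t' t = y.
    by rewrite /pat; case: Hxy => -[_ [-> ->]]; rewrite ?ltnn ?ltnSn.
  exact: occurs_switch.
have -> : pat t' s = pat t s.
  rewrite /pat; case: Hxy => -[_ [_ ->]] //.
  by rewrite ltnS leq_eqVlt (negbTE ne_st).
have occ_s := He s sS ne_st.
have [far|near] := boolP ((s + size p <= t) || (t + size p <= s)).
  apply: occurs_untouched => // k; rewrite size_pat -eq_size_xy size_x; lia.
move: ne_st; rewrite neq_ltn => /orP[lt_st|lt_ts].
- have [d Ed] : exists d, t = s + d by exists (t - s); lia.
  have bd : 0 < d < size p by lia.
  move: Hx occ_s tS; rewrite Ed /pat => Hx occ_s tS.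
  have [Lpq Lqp _ _] := st d bd (spS s d sS tS bd).
  have lt_s : s < s + d by lia.
  move: occ_s; rewrite lt_s => occ_s.
  by case: Hxy Hx => -[-> [-> _]]; [apply: Lpq | apply: Lqp].
- have [d Ed] : exists d, s = t + d by exists (s - t); lia.
  have bd : 0 < d < size p by lia.
  move: Hx occ_s sS; rewrite Ed /pat => Hx occ_s sS.
  have [_ _ Rpq Rqp] := st d bd (spS t d tS sS bd).
  have nlt_s : (t + d < t) = false by lia.
  move: occ_s; rewrite nlt_s => occ_s.
  by case: Hxy Hx => -[-> [-> _]]; [apply: Rpq | apply: Rqp].
Qed.

Lemma count_mixedS t : spaced ->
  count (mixed t.+1) (invs n) = count (mixed t) (invs n).
Proof.
move=> spS; case: (sw) => eq_size eq_mem /andP[ok_pq ok_qp] _ _.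
have eq_mem' : q =i p by move=> i.
have eq_pat s : s != t -> pat t.+1 s = pat t s.
  by move=> ne; rewrite /pat ltnS leq_eqVlt (negbTE ne).
have [tS|tNS] := boolP (t \in S); last first.
  apply: eq_count => e; apply: eq_in_all => s sS; rewrite eq_pat //.
  by apply: contraNneq tNS => <-.
apply: (@count_bij _ _ _ _ (switch t p q) (switch t q p)); first exact: invs_uniq.
- move=> e e_inv /mixedP He.
  have occ_t : occurs p e t by have := He t tS; rewrite /pat ltnSn.
  split; [exact: switch_invs | | exact: switchK].
  apply: mixed_switch => //; first by left.
  by move=> s sS ne; rewrite -eq_pat //; apply: He.
- move=> e e_inv /mixedP He.
  have occ_t : occurs q e t by have := He t tS; rewrite /pat ltnn.
  split; [exact: switch_invs | | exact: switchK].
  apply: mixed_switch => //; first by right.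
  by move=> s sS ne; apply: He.
Qed.

(** If two marked positions lie at a distance at which [p] cannot overlap itself, the same holds for
    [q] by [sw_overlap], and both counts vanish. Otherwise the threshold descends from [n], above
    all marked positions, to 0. *)
Lemma count_marked : {in S, forall s, s < n} ->
  count (fun e => all (occ p e) S) (invs n) =
  count (fun e => all (occ q e) S) (invs n).
Proof.
move=> ltS.
have [sp|nsp] := boolP (all (fun s => all (fun d =>
    (s + d \in S) ==> overlap d p p) (iota 1 (size p).-1)) S).
  have spS : spaced.
    move=> s d sS sdS bd; move: sp => /allP/(_ s sS)/allP/(_ d).
    by rewrite mem_iota sdS; apply; lia.
  transitivity (count (mixed n) (invs n)).
    apply: eq_count => e; apply: eq_in_all => s sS.
    by rewrite /pat ltS.
  transitivity (count (mixed 0) (invs n)); last first.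
    by apply: eq_count => e; apply: eq_in_all => s sS.
  by elim: {1}n => [//|m <-]; apply: count_mixedS.
case: sw => eq_size _ _ eq_ov _.
have [s sS [d [bd sdS nov]]] : exists2 s, s \in S &
    exists d, [/\ 0 < d < size p, s + d \in S & ~~ overlap d p p].
  move: nsp; rewrite -has_predC => /hasP[s sS] /=; rewrite -has_predC => /hasP[d].
  rewrite mem_iota /= negb_imply => bd /andP[sdS nov]; exists s => //.
  by exists d; split=> //; lia.
have none r : is_pattern r -> ~~ overlap d r r ->
    count (fun e => all (occ r e) S) (invs n) = 0.
  move=> pat_r nov_r; apply/eqP; rewrite -leqn0 leqNgt -has_count.
  apply/hasPn => e _; apply: contra nov_r => /allP H.
  apply: (@occurs_overlap r e s d); exact/occP/H.
by rewrite !none // -eq_ov.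
Qed.

End MarkedOccurrences.

(** * Inclusion-exclusion over marked positions *)

(** Downward induction on [T]: the elements with [T \subset f x] split according to [f x], and the
    terms for proper supersets of [T] cancel by induction. *)
Lemma eq_card_of_supersets (X I : finType) (A : {set X}) (f g : X -> {set I}) :
  (forall S : {set I}, #|[set x in A | S \subset f x]| =
                       #|[set x in A | S \subset g x]|) ->
  forall T : {set I}, #|[set x in A | f x == T]| = #|[set x in A | g x == T]|.
Proof.
move=> eq_sup T; have [m] := ubnP #|~: T|; elim: m T => // m IH T ltm.
have split_sup (h : X -> {set I}) : #|[set x in A | T \subset h x]| =
    \sum_(U : {set I} | T \subset U) #|[set x in A | h x == U]|.
  rewrite -sum1_card (partition_big h (fun U => T \subset U)) /=; last first.
    by move=> x; rewrite inE => /andP[].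
  apply: eq_bigr => U TU; rewrite -sum1_card; apply: eq_bigl => x.
  by rewrite !inE; case: eqP => [->|_]; rewrite ?TU ?andbT ?andbF.
have := eq_sup T; rewrite !split_sup (bigD1 T) //= [RHS](bigD1 T) //=.
set a := \sum_(_ | _) _; set b := \sum_(_ | _) _.
suff -> : a = b by apply: addIn.
apply: eq_bigr => U /andP[TU neU]; apply: IH.
rewrite -ltnS; apply: leq_trans ltm; rewrite ltnS; apply: proper_card.
rewrite properEneq.
by rewrite setCS TU (inj_eq (can_inj (@setCK I))) neU.
Qed.

Lemma switchable_super_strong p q : is_pattern p -> is_pattern q ->
  switchable p q -> super_strong_wilf_equiv p q.
Proof.
move=> pat_p pat_q sw n; apply: eq_card_of_supersets => S.
have E r : #|[set e in invseqs n | S \subset Em r e]| =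
    count (fun e => all (occ r e) (map val (enum S))) (invs n).
  rewrite -card_invseqs; apply: eq_card => e; rewrite !inE; congr (_ && _).
  apply/subsetP/allP => [H _ /mapP[i iS ->]|H i iS].
    by have := H i; rewrite inE; apply; rewrite -mem_enum.
  by rewrite inE; apply: H; apply: map_f; rewrite mem_enum.
rewrite !E; apply: count_marked => // _ /mapP[i _ ->]; exact: ltn_ord.
Qed.

Lemma super_strong_trans p q r : super_strong_wilf_equiv p q ->
  super_strong_wilf_equiv q r -> super_strong_wilf_equiv p r.
Proof. by move=> pq qr n T; rewrite pq. Qed.

Lemma super_strong_sym p q : super_strong_wilf_equiv p q ->
  super_strong_wilf_equiv q p.
Proof. by move=> pq n T; rewrite pq. Qed.

(** * Deciding switchability *)

Definition basic_ok (p q : seq nat) : bool :=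
  [&& size p == size q, all (mem q) p, all (mem p) q,
      leftward_ok p q, leftward_ok q p &
      all (fun d => overlap d p p == overlap d q q) (iota 1 (size p).-1)].

(** A left neighbour at distance [d] meets only the first [size p - d] letters of the switched
    occurrence, a right one only the last [size p - d]. *)
Definition left_untouched (d : nat) (p q : seq nat) : bool :=
  all (fun k => nth 0 p k == nth 0 q k) (iota 0 (size p - d)).

Definition right_untouched (d : nat) (p q : seq nat) : bool :=
  all (fun k => nth 0 p (d + k) == nth 0 q (d + k)) (iota 0 (size p - d)).

Lemma stable_left_untouched d (z p q : seq nat) :
  size z = size p -> size p = size q -> p =i q ->
  left_untouched d p q -> stable_left d z p q.
Proof.
move=> size_z eq_size eq_mem /all_iotaP un e s; apply: occurs_untouched => //.
by move=> k ltk in_k; apply/eqP/un; lia.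
Qed.

Lemma stable_right_untouched d (z p q : seq nat) :
  size z = size p -> size p = size q -> p =i q ->
  right_untouched d p q -> stable_right d z p q.
Proof.
move=> size_z eq_size eq_mem /all_iotaP un e t; apply: occurs_untouched => //.
move=> k ltk in_k; rewrite -addnA addKn; apply/eqP/un; lia.
Qed.

Lemma all_iota1P n (P : pred nat) :
  reflect (forall d, 0 < d < n -> P d) (all P (iota 1 n.-1)).
Proof.
have mem_d d : (d \in iota 1 n.-1) = (0 < d < n).
  by case: n d => [|m] [|d]; rewrite mem_iota.
by apply: (iffP allP) => H d; [rewrite -mem_d|rewrite mem_d]; apply: H.
Qed.

Lemma switchable_of_bool p q : basic_ok p q ->
  (forall d, 0 < d < size p -> overlap d p p ->
    (left_untouched d p q \/ stable_left d p p q /\ stable_left d p q p) /\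
    (right_untouched d p q \/ stable_right d q p q /\ stable_right d q q p)) ->
  switchable p q.
Proof.
case/and5P=> /eqP eq_size /allP pq /allP qp ok_pq.
case/andP=> ok_qp /all_iota1P eq_ov st.
have eq_mem : p =i q by move=> x; apply/idP/idP => [/pq|/qp].
have eq_mem' : q =i p by move=> x.
have lu d : left_untouched d p q -> left_untouched d q p.
  by rewrite /left_untouched eq_size; under eq_all do rewrite eq_sym.
have ru d : right_untouched d p q -> right_untouched d q p.
  by rewrite /right_untouched eq_size; under eq_all do rewrite eq_sym.
split=> // [|d /eq_ov/eqP //|d bd ov]; first by rewrite ok_pq.
have [L R] := st d bd ov.
have [L1 L2] : stable_left d p p q /\ stable_left d p q p.
  case: L => // un; split; apply: stable_left_untouched => //; exact: lu.
have [R1 R2] : stable_right d q p q /\ stable_right d q q p.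
  case: R => // un; split; apply: stable_right_untouched => //; exact: ru.
by split.
Qed.

Definition switchable_bool (p q : seq nat) : bool :=
  [&& is_pattern p, is_pattern q, basic_ok p q &
      all (fun d => overlap d p p ==>
        left_untouched d p q && right_untouched d p q) (iota 1 (size p).-1)].

Lemma switchable_bool_super_strong p q : switchable_bool p q ->
  super_strong_wilf_equiv p q.
Proof.
case/and4P=> pat_p pat_q ok /all_iota1P un; apply: switchable_super_strong => //.
apply: switchable_of_bool => // d bd ov.
by have := un d bd; rewrite ov => /andP[]; split; left.
Qed.

Lemma switch_pos_addl s t p q j :
  switch_pos (s + t) p q (s + j) = s + switch_pos t p q j.
Proof.
rewrite /switch_pos leq_add2l -addnA ltn_add2l subnDl.
by case: ifP; rewrite ?addnA.
Qed.

(** Moving the left occurrence to position 0 turns stability into a statement about finitely many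
    values [w k], within reach of linear arithmetic. *)
Lemma stable_left_window d (z p q : seq nat) : size p = size q ->
  (forall w, follows z w -> follows p (fun k => w (d + k)) ->
     follows z (fun k => w (switch_pos d p q k))) ->
  stable_left d z p q.
Proof.
move=> eq_size H e s [le_z Hz] [le_p Hp]; split; first by rewrite size_switch.
apply: follows_ext (H (fun k => nth 0 e (s + k)) Hz _) => [k _|].
  by rewrite nth_switch // switch_pos_addl.
by apply: follows_ext Hp => k _; rewrite addnA.
Qed.

Lemma stable_right_window d (z p q : seq nat) : size p = size q ->
  (forall w, follows z (fun k => w (d + k)) -> follows p w ->
     follows z (fun k => w (switch_pos 0 p q (d + k)))) ->
  stable_right d z p q.
Proof.
move=> eq_size H e t [le_z Hz] [le_p Hp]; split; first by rewrite size_switch.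
apply: follows_ext (H (fun k => nth 0 e (t + k)) _ Hp) => [k _|].
  by rewrite nth_switch // -addnA -switch_pos_addl addn0.
by apply: follows_ext Hz => k _; rewrite addnA.
Qed.

Ltac comparisons H :=
  move: (H 0 1 isT isT) (H 0 2 isT isT) (H 0 3 isT isT)
        (H 1 0 isT isT) (H 1 2 isT isT) (H 1 3 isT isT)
        (H 2 0 isT isT) (H 2 1 isT isT) (H 2 3 isT isT)
        (H 3 0 isT isT) (H 3 1 isT isT) (H 3 2 isT isT).

Ltac window_cases :=
  case=> [|[|[|[|//]]]] [|[|[|[|//]]]] _ _;
  rewrite /switch_pos /addn /subn /=; lia.

(* In the next three lemmas occurrences may share two entries, and the switch
   moves one of these; exchanging the two patterns would break the neighbour. *)
Lemma super_strong_0102_0112 :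
  super_strong_wilf_equiv [:: 0;1;0;2] [:: 0;1;1;2].
Proof.
apply: switchable_super_strong => //; apply: switchable_of_bool => //.
case=> [|[|[|[|//]]]] // _ _; split; try by left.
(* Left over is [d = 2]: the switch moves [w 2] between the values of [w 0] and [w 1], both below
   [w 3]. The neighbour 0112 uses its first letter only once, so it survives; 0102 would not. *)
right; split; apply: stable_right_window => // w Hz Hp;
  comparisons Hz; comparisons Hp; rewrite /addn /= => *; window_cases.
Qed.

Lemma super_strong_2120_2110 :
  super_strong_wilf_equiv [:: 2;1;2;0] [:: 2;1;1;0].
Proof.
apply: switchable_super_strong => //; apply: switchable_of_bool => //.
case=> [|[|[|[|//]]]] // _ _; split; try by left.
right; split; apply: stable_right_window => // w Hz Hp;
  comparisons Hz; comparisons Hp; rewrite /addn /= => *; window_cases.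
Qed.

Lemma super_strong_2110_2010 :
  super_strong_wilf_equiv [:: 2;1;1;0] [:: 2;0;1;0].
Proof.
apply: switchable_super_strong => //; apply: switchable_of_bool => //.
case=> [|[|[|[|//]]]] // _ _; split; try by left.
(* Here [w 3] is altered, the last letter of the left neighbour 2110; it is not repeated there and
   stays below [w 2]. *)
right; split; apply: stable_left_window => // w Hz Hp;
  comparisons Hz; comparisons Hp; rewrite /addn /= => *; window_cases.
Qed.

Lemma super_strong_groups g p p' : g \in groups -> p \in g -> p' \in g ->
  super_strong_wilf_equiv p p'.
Proof.
(* These pairs differ in letters shared by overlapping occurrences, so [switchable_bool] rejects
   them. *)
pose chained := [:: ([:: 0;1;0;2], [:: 0;1;1;2]); ([:: 2;1;2;0], [:: 2;1;1;0]);
  ([:: 2;1;1;0], [:: 2;0;1;0]); ([:: 2;1;2;0], [:: 2;0;1;0])].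
have chainedP q r : (q, r) \in chained -> super_strong_wilf_equiv q r.
  rewrite !inE => /or4P[] /eqP[-> ->].
  - exact: super_strong_0102_0112.
  - exact: super_strong_2120_2110.
  - exact: super_strong_2110_2010.
  - exact: super_strong_trans super_strong_2120_2110 super_strong_2110_2010.
have /allP H : all (fun g => all (fun q => all (fun r =>
    [|| q == r, switchable_bool q r, (q, r) \in chained | (r, q) \in chained])
    g) g) groups by vm_compute.
move=> /H/allP/(_ p) Hp pg p'g; have /allP/(_ p' p'g) := Hp pg.
case/or4P => [/eqP-> //||/chainedP //|/chainedP/super_strong_sym //].
exact: switchable_bool_super_strong.
Qed.

(** * Counting avoiders *)

Definition avoids (p e : seq nat) : bool :=
  all (fun i => ~~ occ p e i) (iota 0 (size e)).

Lemma wilf_count p p' n : wilf_equiv p p' ->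
  count (avoids p) (invs n) = count (avoids p') (invs n).
Proof.
move=> /(_ n).
have E r : #|[set e in invseqs n | Em r e == set0]| = count (avoids r) (invs n).
  rewrite -card_invseqs; apply: eq_card => e; rewrite !inE; congr (_ && _).
  rewrite /avoids size_map size_tuple; apply/eqP/all_iotaP => [H i ltin|H].
    by move/setP/(_ (Ordinal ltin)): H; rewrite !inE /= => ->.
  by apply/setP => i; rewrite !inE; apply/negbTE/H.
by rewrite !E.
Qed.

Lemma occ_rcons p e x i : i + size p <= size e -> occ p (rcons e x) i = occ p e i.
Proof.
move=> le_e; rewrite /occ size_rcons le_e leqW //=; congr (red _ == p).
rewrite drop_rcons; last by apply: leq_trans le_e; exact: leq_addr.
by rewrite -cats1 takel_cat // size_drop; lia.
Qed.

(** A new last entry can complete an occurrence only in the last window; the guard ensures that the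
    subtraction is not truncated. *)
Lemma avoids_rcons (p e : seq nat) x : is_pattern p -> 0 < size p ->
  avoids p (rcons e x) =
  avoids p e && ((size p <= (size e).+1) ==>
                 ~~ occ p (rcons e x) ((size e).+1 - size p)).
Proof.
move=> pp p_gt0; apply/all_iotaP/andP => [H|[/all_iotaP H /implyP Hx] i lti].
  split; last by apply/implyP => le_p; apply: H; rewrite size_rcons; lia.
  apply/all_iotaP => i lti; case: (leqP (i + size p) (size e)) => le_e.
    by rewrite -(occ_rcons x le_e); apply: H; rewrite size_rcons ltnW.
  by rewrite /occ leqNgt le_e.
have := H i; case: (leqP (i + size p) (size e)) => [le_e|gt_e].
  by rewrite occ_rcons //; apply; lia.
move=> _; have [|gt_e'] := leqP (i + size p) (size e).+1; last first.
  by rewrite /occ size_rcons leqNgt gt_e'.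
move=> le_e; have -> : i = (size e).+1 - size p by lia.
by apply: Hx; lia.
Qed.

Fixpoint extensions (p : seq nat) (k : nat) (e : seq nat) : nat :=
  if k is k'.+1 then
    \sum_(x <- iota 0 (size e).+1) extensions p k' (rcons e x)
  else avoids p e.

Lemma count_avoids p n k :
  count (avoids p) (invs (n + k)) = \sum_(e <- invs n) extensions p k e.
Proof.
elim: k n => [|k IH] n.
  by rewrite addn0 -sum1_count big_mkcond; apply: eq_bigr => e _ /=; case: avoids.
rewrite addnS -addSn IH invsS big_allpairs_dep.
apply: eq_big_seq => e; rewrite mem_invs => /andP[/eqP sz _] /=.
by rewrite sz.
Qed.

(** Binary numbers, because the counts at length 11 are too large for unary computation. *)
Definition sumN := foldr N.add 0%num.

Lemma sumN_E s : N.to_nat (sumN s) = \sum_(x <- s) N.to_nat x.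
Proof.
elim: s => [|x s IH]; first by rewrite big_nil.
by rewrite big_cons -IH /= N2Nat.inj_add plusE.
Qed.

(* Number of ways to extend by [k] entries, without creating an occurrence of
   [p], an avoider of length [n] ending in [a], [b], [c]. *)
Fixpoint ext3 (p : seq nat) (k n a b c : nat) : N :=
  if k is k'.+1 then
    sumN [seq ext3 p k' n.+1 b c d |
           d <- iota 0 n.+1 & ~~ order_iso p [:: a; b; c; d]]
  else 1%num.

Lemma extensionsS p k e : extensions p k.+1 e =
  \sum_(x <- iota 0 (size e).+1) extensions p k (rcons e x).
Proof. by []. Qed.

Lemma ext3S p k n a b c : ext3 p k.+1 n a b c =
  sumN [seq ext3 p k n.+1 b c d |
         d <- iota 0 n.+1 & ~~ order_iso p [:: a; b; c; d]].
Proof. by []. Qed.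

Lemma extensions_ext3 p k e a b c : is_pattern p -> size p = 4 ->
  avoids p (e ++ [:: a; b; c]) ->
  extensions p k (e ++ [:: a; b; c]) = N.to_nat (ext3 p k (size e + 3) a b c).
Proof.
move=> pp sz_p; elim: k e a b c => [|k IH] e a b c av; first by rewrite /= av.
rewrite ext3S extensionsS sumN_E big_map big_filter [RHS]big_mkcond.
rewrite size_cat [size [:: a; b; c]]/=.
apply: eq_bigr => d _.
have E : rcons (e ++ [:: a; b; c]) d = rcons e a ++ [:: b; c; d].
  by rewrite -!cats1 -!catA.
have sz_e : (size (e ++ [:: a; b; c])).+1 - size p = size e.
  by rewrite size_cat sz_p /= -addnS addnK.
have := avoids_rcons (e ++ [:: a; b; c]) d pp.
rewrite sz_e sz_p av size_cat => /(_ isT) /=.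
have -> : 3 < (size e + 3).+1 by lia.
have -> : occ p (rcons (e ++ [:: a; b; c]) d) (size e) =
    order_iso p [:: a; b; c; d].
  rewrite /occ -cats1 -catA drop_size_cat // sz_p /= red_eq //.
  by rewrite !size_cat /= addnS leqnn.
rewrite E /=; case: ifP => [_ av_d|_ av_d].
  by rewrite IH // size_rcons addSn addnS.
(* An occurrence is never lost by extending. *)
have ext0 j f : avoids p f = false -> extensions p j f = 0.
  elim: j f => [|j IHj] f /= avf; first by rewrite avf.
  apply: big1_seq => x _; apply: IHj.
  by rewrite avoids_rcons ?sz_p // avf.
exact: ext0.
Qed.

(** * Tabulating the recursion *)

Definition indexed {A} (s : seq A) := zip (iota 0 (size s)) s.

Lemma indexed_map_iota A (f : nat -> A) n :
  indexed [seq f i | i <- iota 0 n] = [seq (i, f i) | i <- iota 0 n].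
Proof.
rewrite /indexed size_map size_iota -{1}[iota 0 n]map_id; exact: zip_map.
Qed.

(** Dynamic programming: the table for length [n.+1] is indexed by [b], [c], [d] in this order, so
    traversing it for each [a] yields the table for length [n]. The [if] makes call-by-value
    evaluation compare four letters only when the first three fit. *)
Definition step (p : seq nat) (n : nat) (T : seq (seq (seq N))) :=
  [seq [seq [seq
     let m := order_iso (take 3 p) [:: a; bU.1; cs.1] in
     sumN [seq dv.2 | dv <- indexed cs.2 &
                      if m then ~~ order_iso p [:: a; bU.1; cs.1; dv.1] else true]
     | cs <- indexed bU.2] | bU <- indexed T] | a <- iota 0 (n - 2)].

(** The last three entries of an inversion sequence of length [n] are at most [n - 3], [n - 2],
    [n - 1], whence the dimensions. *)
Fixpoint table (p : seq nat) (k n : nat) : seq (seq (seq N)) :=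
  if k is k'.+1 then step p n (table p k' n.+1)
  else [seq [seq [seq 1%num | c <- iota 0 n] | b <- iota 0 (n - 1)]
       | a <- iota 0 (n - 2)].

Lemma order_iso_prefix p w d : size p = (size w).+1 ->
  order_iso p (rcons w d) -> order_iso (take (size w) p) w.
Proof.
move=> sz /order_isoP H; apply/order_isoP => i j.
rewrite size_take sz ltnSn => lti ltj; rewrite !nth_take //.
have := H i j; rewrite sz !ltnS (ltnW lti) (ltnW ltj) !nth_rcons lti ltj.
exact.
Qed.

Lemma tableE p k n : size p = 4 -> 1 < n ->
  table p k n = [seq [seq [seq ext3 p k n a b c | c <- iota 0 n]
    | b <- iota 0 (n - 1)] | a <- iota 0 (n - 2)].
Proof.
move=> sz; elim: k n => [//|k IH] n n_gt1.
rewrite -[LHS]/(step p n (table p k n.+1)) IH 1?ltnW // /step.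
have [-> ->] : n.+1 - 2 = n - 1 /\ n.+1 - 1 = n by lia.
apply: eq_map => a; rewrite indexed_map_iota -map_comp; apply: eq_map => b.
cbv beta iota delta [fst snd comp].
rewrite indexed_map_iota -map_comp; apply: eq_map => c.
cbv beta zeta iota delta [fst snd comp].
rewrite indexed_map_iota filter_map -map_comp ext3S; congr sumN.
congr map; apply: eq_filter => d /=.
(* If the first three letters do not fit, no [d] completes [p]. *)
case: ifP => // /negbT not_m; symmetry; apply: contra not_m => iso_d.
by have := @order_iso_prefix p [:: a; b; c] d; rewrite sz; apply.
Qed.

Definition avoiders (p : seq nat) (k : nat) : N :=
  sumN [seq sumN (map sumN T) | T <- table p k 3].

Lemma count_avoiders p k : is_pattern p -> size p = 4 ->
  count (avoids p) (invs (3 + k)) = N.to_nat (avoiders p k).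
Proof.
move=> pp sz; rewrite count_avoids /avoiders tableE // sumN_E.
have av e : size e < 4 -> avoids p e.
  move=> lt4; apply/all_iotaP => i lti; rewrite /occ sz leqNgt.
  by rewrite (leq_trans lt4) // leq_addl.
(* Every inversion sequence of length 3 has the form [[:: 0; b; c]]. *)
have E b c : extensions p k [:: 0; b; c] = N.to_nat (ext3 p k 3 0 b c).
  by rewrite (@extensions_ext3 p k [::] 0 b c pp sz (av _ _)).
by rewrite /= !(big_cons, big_nil) /= !E !N2Nat.inj_add /=; lia.
Qed.

(** * Separating the groups *)

Fixpoint words (k n : nat) : seq (seq nat) :=
  if k is k'.+1 then [seq a :: w | a <- iota 0 n, w <- words k' n]
  else [:: [::]].

Lemma mem_words k n w : size w = k -> all (fun a => a < n) w -> w \in words k n.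
Proof.
elim: k w => [|k IH] [|a w] //= [sz] /andP[lta ltw].
by apply/allpairsP; exists (a, w); rewrite mem_iota add0n IH.
Qed.

Definition avoider_counts (k : nat) : seq (seq nat * N) :=
  [seq (p, avoiders p k) | p <- words 4 4 & is_pattern p].

Definition separates (counts : seq (seq nat * N)) : bool :=
  all (fun x => all (fun y =>
    if N.eqb x.2 y.2 then (x.1 == y.1) || same_group x.1 y.1 else true)
    counts) counts.

Lemma separatesP counts p q m : separates counts ->
  (p, m) \in counts -> (q, m) \in counts -> p != q -> same_group p q.
Proof.
move=> /allP H /H/allP {}H /H /=.
by rewrite N.eqb_refl => /orP[/eqP->|//]; rewrite eqxx.
Qed.

(* Length 3 + 8 = 11 is the least length at which the numbers of avoiders
   separate all the groups. *)
Lemma avoiders_separate : separates (avoider_counts 8).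
Proof. by vm_compute. Qed.

Lemma mem_avoider_counts k p : is_pattern p -> size p = 4 ->
  (p, avoiders p k) \in avoider_counts k.
Proof.
move=> pp sz; apply/map_f; rewrite mem_filter pp mem_words //.
by case/andP: pp; rewrite sz.
Qed.

Lemma wilf_same_group p p' : is_pattern p -> is_pattern p' ->
  size p = 4 -> size p' = 4 -> p != p' -> wilf_equiv p p' -> same_group p p'.
Proof.
move=> pp pp' sz sz' ne /(wilf_count (3 + 8)).
rewrite !count_avoiders // => /N2Nat.inj eq_count.
apply: (separatesP avoiders_separate (mem_avoider_counts 8 pp sz)) => //.
by rewrite eq_count mem_avoider_counts.
Qed.

Theorem theorem1 :
  (forall (g : seq (seq nat)) (p p' : seq nat), g \in groups -> p \in g -> p' \in g ->
      super_strong_wilf_equiv p p') /\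
  (forall p p' : seq nat, is_pattern p -> is_pattern p' ->
      size p = 4 -> size p' = 4 -> p != p' ->
      wilf_equiv p p' -> same_group p p').
Proof.
split; [exact: super_strong_groups | exact: wilf_same_group].
Qed.
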